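(* Let $\mathcal X_1$ and $\mathcal X_2$ be topological spaces, let $\mathcal Z_1$ and $\mathcal Z_2$ be Hilbert spaces, and let $\mathcal Z_{\rm c}$ be a finite-dimensional Hilbert space. For $i=1,2$ let $\mathcal D_i=(\mathcal D_{i,x_i})_{x_i\in\mathcal X_i}$ be a modulated Dirac structure with $\mathcal D_{i,x_i}\subset(\mathcal Z_i\times\mathcal Z_{\rm c})^2$. For $(x_1,x_2)\in\mathcal X_1\times\mathcal X_2$ define the linear map $$\Gamma_{x_1,x_2}:\mathcal D_{1,x_1}\times\mathcal D_{2,x_2}\to\mathcal Z_{\rm c}\times\mathcal Z_{\rm c},\qquad (d_1,d_2)\mapsto\begin{pmatrix} f_{{\rm c}1}-f_{{\rm c}2}\\ e_{{\rm c}1}+e_{{\rm c}2}\end{pmatrix},$$ where $f_{{\rm c}i},e_{{\rm c}i}\in\mathcal Z_{\rm c}$ denote the coupling components of $d_i=\left(\begin{pmatrix} f_i\\ f_{{\rm c}i}\end{pmatrix},\begin{pmatrix} e_i\\ e_{{\rm c}i}\end{pmatrix}\right)$. Assume that $\Gamma_{x_1,x_2}$ is surjective for every $(x_1,x_2)\in\mathcal X_1\times\mathcal X_2$. Then the interconnection $$\mathcal D_1\circ_{\mathcal Z_{\rm c}}\mathcal D_2=\bigl(\mathcal D_{1,x_1}\circ_{\mathcal Z_{\rm c}}\mathcal D_{2,x_2}\bigr)_{(x_1,x_2)\in\mathcal X_1\times\mathcal X_2}$$ is a modulated Dirac structure (over the product topological space $\mathcal X_1\times\mathcal X_2$, with underlying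 Hilbert space $\mathcal Z_1\times\mathcal Z_2$).
   Context: All Hilbert spaces are real. $L(\mathcal W,\mathcal Y)$ denotes the bounded linear operators between Hilbert spaces, with the operator norm. Power pairing: for a Hilbert space $\mathcal Z$ and $(f_1,e_1),(f_2,e_2)\in\mathcal Z\times\mathcal Z$ (flow first, effort second), $\langle\!\langle (f_1,e_1),(f_2,e_2)\rangle\!\rangle:=\langle f_1,e_2\rangle_{\mathcal Z}+\langle f_2,e_1\rangle_{\mathcal Z}$. For $\mathcal M\subset\mathcal Z\times\mathcal Z$, $\mathcal M^{\perp\!\!\!\perp}$ is the set of all $z\in\mathcal Z\times\mathcal Z$ with $\langle\!\langle z,m\rangle\!\rangle=0$ for all $m\in\mathcal M$. A subspace $\mathcal D\subset\mathcal Z\times\mathcal Z$ is a Dirac structure if $\mathcal D=\mathcal D^{\perp\!\!\!\perp}$. Modulated Dirac structure: for a topological space $\mathcal X$ and a Hilbert space $\mathcal Z$, a family $(\mathcal D_x)_{x\in\mathcal X}$ of subsets $\mathcal D_x\subset\mathcal Z\times\mathcal Z$ is a modulated Dirac structure if (a) every $\mathcal D_x$ is a Dirac structure, and (b) there is a Hilbert space $\mathcal W$ such that for every $x\in\mathcal X$ there exist an open neighborhood $U_x\subset\mathcal X$ of $x$ and operators $T_y\in L(\mathcal W,\mathcal Z\times\mathcal Z)$, $y\in U_x$, such that each $T_y$ is a bijection from $\mathcal W$ onto $\mathcal D_y$ and $y\mapsto T_y$ is continuous in operator norm. Interconnection: $\mathcal D_{1,x_1}\circ_{\mathcal Z_{\rm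 c}}\mathcal D_{2,x_2}\subset(\mathcal Z_1\times\mathcal Z_2)^2$ is the set of all $\left(\begin{pmatrix} f_1\\ f_2\end{pmatrix},\begin{pmatrix} e_1\\ e_2\end{pmatrix}\right)$ for which there exist $f_{\rm c},e_{\rm c}\in\mathcal Z_{\rm c}$ with $\left(\begin{pmatrix} f_1\\ f_{\rm c}\end{pmatrix},\begin{pmatrix} e_1\\ e_{\rm c}\end{pmatrix}\right)\in\mathcal D_{1,x_1}$ and $\left(\begin{pmatrix} f_2\\ f_{\rm c}\end{pmatrix},\begin{pmatrix} e_2\\ -e_{\rm c}\end{pmatrix}\right)\in\mathcal D_{2,x_2}$. *)

(* Defs.v *)
From HB Require Import structures.
From mathcomp Require Import all_boot all_order all_algebra.
From mathcomp Require Import all_classical all_reals all_analysis.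
From mathcomp Require Import ring lra.

Set Implicit Arguments.
Unset Strict Implicit.
Unset Printing Implicit Defensive.

Import Order.TTheory GRing.Theory Num.Theory.
Import numFieldNormedType.Exports.

Local Open Scope classical_set_scope.
Local Open Scope ring_scope.

(* A real Hilbert space is a complete normed module whose norm is induced by an
   inner product; definiteness of the inner product follows from that of the
   norm. *)
HB.mixin Record CompleteNormedModule_isHilbert (R : realType) V
    & CompleteNormedModule R V := {
  inner : V -> V -> R;
  innerC : forall x y, inner x y = inner y x;
  innerPl : forall a x y z, inner (a *: x + y) z = a * inner x z + inner y z;
  innerxx : forall x, inner x x = `|x| ^+ 2
}.

#[short(type="hilbertType")]
HB.structure Definition Hilbert (R : realType) :=
  {V of CompleteNormedModule R V & CompleteNormedModule_isHilbert R V}.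

(* The Hilbert space product. An alias of V * W is needed because the norm of
   the library on V * W is the maximum of the norms, which is not induced by an
   inner product. *)
Definition hprod (R : realType) (V W : hilbertType R) : Type := (V * W)%type.

Section hprod.
Context {R : realType} (V W : hilbertType R).
Local Notation VW := (hprod V W).

HB.instance Definition _ := GRing.Lmodule.copy VW (V * W)%type.

Definition hprod_inner (x y : VW) : R := inner x.1 y.1 + inner x.2 y.2.

Definition hprod_norm (x : VW) : R := Num.sqrt (hprod_inner x x).

Let innerC' x y : hprod_inner x y = hprod_inner y x.
Proof. by rewrite /hprod_inner innerC [X in _ + X]innerC. Qed.

Let innerPl' a x y z :
  hprod_inner (a *: x + y) z = a * hprod_inner x z + hprod_inner y z.
Proof. by rewrite /hprod_inner /= !innerPl mulrDr addrACA. Qed.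

Let inner_ge0 x : 0 <= hprod_inner x x.
Proof. by rewrite /hprod_inner !innerxx addr_ge0 ?sqr_ge0. Qed.

Let innerxx' x : hprod_inner x x = hprod_norm x ^+ 2.
Proof. by rewrite /hprod_norm sqr_sqrtr. Qed.

Let inner0 x : hprod_inner 0 x = 0.
Proof. by have := innerPl' (-1) x x x; rewrite scaleN1r addNr mulN1r addNr. Qed.

Let innerZl a x z : hprod_inner (a *: x) z = a * hprod_inner x z.
Proof. by rewrite -[a *: x]addr0 innerPl' inner0 addr0. Qed.

Let innerD x y z : hprod_inner (x + y) z = hprod_inner x z + hprod_inner y z.
Proof. by rewrite -[x]scale1r innerPl' mul1r scale1r. Qed.

Let innerDr x y z : hprod_inner z (x + y) = hprod_inner z x + hprod_inner z y.
Proof. by rewrite !(innerC' z) innerD. Qed.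

Let innerZr a x z : hprod_inner z (a *: x) = a * hprod_inner z x.
Proof. by rewrite !(innerC' z) innerZl. Qed.

Let normZ a x : hprod_norm (a *: x) = `|a| * hprod_norm x.
Proof.
rewrite /hprod_norm innerZl innerC' innerZl mulrA -expr2.
by rewrite sqrtrM ?sqr_ge0// sqrtr_sqr.
Qed.

Let norm_eq0 x : hprod_norm x = 0 -> x = 0.
Proof.
move=> x0; have := innerxx' x; rewrite x0 expr0n /= /hprod_inner !innerxx.
move=> /eqP; rewrite paddr_eq0 ?sqr_ge0// !sqrf_eq0 !normr_eq0.
by case: x {x0} => a b /= /andP[/eqP-> /eqP->].
Qed.

Let cauchy_schwarz x y : hprod_inner x y <= hprod_norm x * hprod_norm y.
Proof.
have [x0|x0] := eqVneq (hprod_norm x) 0.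
  by rewrite x0 (norm_eq0 x0) inner0 mul0r.
have [y0|y0] := eqVneq (hprod_norm y) 0.
  by rewrite y0 (norm_eq0 y0) innerC' inner0 mulr0.
have px : 0 < hprod_norm x by rewrite lt_neqAle eq_sym x0 sqrtr_ge0.
have py : 0 < hprod_norm y by rewrite lt_neqAle eq_sym y0 sqrtr_ge0.
have := inner_ge0 (hprod_norm y *: x + (- hprod_norm x) *: y).
rewrite !(innerD, innerDr, innerZl, innerZr) (innerC' y x) !innerxx'.
set a := hprod_norm x in px *; set b := hprod_norm y in py *.
set c := hprod_inner x y => H.
have : 0 <= (a * b) * (a * b - c) *+ 2.
  by apply: (le_trans H); rewrite le_eqVlt; apply/orP; left; apply/eqP; ring.
by rewrite pmulrn_lge0// pmulr_rge0 ?mulr_gt0// subr_ge0.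
Qed.

Let norm_triangle x y : hprod_norm (x + y) <= hprod_norm x + hprod_norm y.
Proof.
rewrite -(@ler_pXn2r _ 2) ?nnegrE ?addr_ge0 ?sqrtr_ge0//.
rewrite -innerxx' !(innerD, innerDr) !innerxx' (innerC' y x).
have := cauchy_schwarz x y.
set a := hprod_norm x; set b := hprod_norm y; set c := hprod_inner x y.
by move=> H; rewrite sqrrD mulr2n; lra.
Qed.

HB.instance Definition _ :=
  @Lmodule_isNormed.Build R VW hprod_norm norm_triangle normZ norm_eq0.

Lemma hprod_normE (x : VW) : `|x| = Num.sqrt (`|x.1| ^+ 2 + `|x.2| ^+ 2).
Proof. by rewrite -!innerxx. Qed.

Let fst_le (x : VW) : `|x.1| <= `|x|.
Proof.
by rewrite hprod_normE -[leLHS]ger0_norm// -sqrtr_sqr ler_wsqrtr// lerDl sqr_ge0.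
Qed.

Let snd_le (x : VW) : `|x.2| <= `|x|.
Proof.
by rewrite hprod_normE -[leLHS]ger0_norm// -sqrtr_sqr ler_wsqrtr// lerDr sqr_ge0.
Qed.

Let le_fst_snd (x : VW) : `|x| <= `|x.1| + `|x.2|.
Proof.
rewrite hprod_normE -[leRHS]ger0_norm ?addr_ge0// -sqrtr_sqr ler_wsqrtr//.
by rewrite sqrrD lerD2r lerDl mulrn_wge0// mulr_ge0.
Qed.

Let hprod_complete (F : set_system VW) : ProperFilter F -> cauchy F -> cvg F.
Proof.
move=> FF /cauchyP Fc.
have c1 : cvg ((@fst V W : VW -> V) @ F).
  apply: cauchy_cvg; apply/cauchyP => e e0; have [x Fx] := Fc e e0.
  exists x.1; change (F [set y : VW | ball x.1 e y.1]).
  apply: filterS Fx => y; rewrite -!ball_normE /= => xy.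
  exact: le_lt_trans (fst_le (x - y)) xy.
have c2 : cvg ((@snd V W : VW -> W) @ F).
  apply: cauchy_cvg; apply/cauchyP => e e0; have [x Fx] := Fc e e0.
  exists x.2; change (F [set y : VW | ball x.2 e y.2]).
  apply: filterS Fx => y; rewrite -!ball_normE /= => xy.
  exact: le_lt_trans (snd_le (x - y)) xy.
move: c1 c2 => /cvg_ex[a Fa] /cvg_ex[b Fb].
apply/cvg_ex; exists ((a, b) : VW); apply/cvgrPdist_lt => e e0.
have e20 : 0 < e / 2 by rewrite divr_gt0.
move/cvgrPdist_lt : Fa => /(_ _ e20) Fa.
move/cvgrPdist_lt : Fb => /(_ _ e20) Fb.
near=> y; rewrite [ltRHS]splitr.
rewrite (le_lt_trans (le_fst_snd _))//= ltrD//.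
- by near: y.
- by near: y.
Unshelve. all: by end_near. Qed.

HB.instance Definition _ := Uniform_isComplete.Build VW hprod_complete.

HB.instance Definition _ :=
  CompleteNormedModule_isHilbert.Build R VW innerC' innerPl' innerxx'.

End hprod.

Definition finite_dimensional (R : realType) (V : hilbertType R) : Prop :=
  exists (n : nat) (b : 'I_n -> V),
    forall v, exists c : 'I_n -> R, v = \sum_(i < n) c i *: b i.

Definition bounded_operator (R : realType) (V W : hilbertType R)
    (T : {linear V -> W}) : Prop :=
  exists M : R, forall x, `|T x| <= M * `|x|.

Definition operator_norm (R : realType) (V W : hilbertType R)
    (T : V -> W) : R :=
  sup [set `|T x| | x in [set x | `|x| <= 1]].

Section dirac.
Context {R : realType} {Z : hilbertType R}.

(* Elements of Z * Z are pairs (flow, effort). *)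
Definition power_pairing (z1 z2 : hprod Z Z) : R :=
  inner z1.1 z2.2 + inner z2.1 z1.2.

Definition power_orthogonal (M : set (hprod Z Z)) : set (hprod Z Z) :=
  [set z | forall m, M m -> power_pairing z m = 0].

Definition dirac_structure (D : set (hprod Z Z)) : Prop :=
  submod_closed [in D] /\ D = power_orthogonal D.

(* The family T is total on X; only its values on the open set U are
   constrained, and these include T y' for y' close to a point y of U. *)
Definition modulated_dirac_structure (X : topologicalType)
    (D : X -> set (hprod Z Z)) : Prop :=
  (forall x, dirac_structure (D x)) /\
  exists W : hilbertType R, forall x : X,
    exists (U : set X) (T : X -> {linear W -> hprod Z Z}),
      [/\ open U, U x,
          forall y, U y -> bounded_operator (T y),
          forall y, U y -> set_bij [set: W] (D y) (T y) &
          forall y, U y ->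
            operator_norm (T y' \- T y) @[y' --> y] --> (0 : R)].

End dirac.

Definition interconnection (R : realType) (Z1 Z2 Zc : hilbertType R)
    (D1 : set (hprod (hprod Z1 Zc) (hprod Z1 Zc)))
    (D2 : set (hprod (hprod Z2 Zc) (hprod Z2 Zc))) :
    set (hprod (hprod Z1 Z2) (hprod Z1 Z2)) :=
  [set d | exists fc ec : Zc,
     D1 ((d.1.1, fc), (d.2.1, ec)) /\ D2 ((d.1.2, fc), (d.2.2, - ec))].

(* The map (d1, d2) |-> (f_c1 - f_c2, e_c1 + e_c2), defined on the ambient space;
   it is restricted to D1 `*` D2 at its point of use. *)
Definition coupling_map (R : realType) (Z1 Z2 Zc : hilbertType R)
    (d : hprod (hprod Z1 Zc) (hprod Z1 Zc) * hprod (hprod Z2 Zc) (hprod Z2 Zc)) :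
    hprod Zc Zc :=
  (d.1.1.2 - d.2.1.2, d.1.2.2 + d.2.2.2).

(* Main.v *)
(* A Dirac structure D on Z is mapped isometrically onto Z by (f, e) |-> f + e,
   so that the inverse of this isometry is a global parametrization of D by Z.
   In terms of it, a family of Dirac structures is modulated if and only if, for
   all x and eps > 0 and all x' near x, the power pairing of m in D_x and m' in
   D_x' is at most eps |m| |m'|; the bounded inverse theorem is used to go from a
   local parametrization to this estimate.
   The power pairing of two elements of the interconnection is the sum of the
   pairings of their lifts to D1 and D2.  By surjectivity of the coupling map,
   the coupling variables of an element of the interconnection are determined
   by its pairings with finitely many elements, hence bounded by its norm,
   uniformly for nearby structures, and the estimate carries over. *)
From HB Require Import structures.
Require Import Defs.
From mathcomp Require Import all_boot all_order all_algebra.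
From mathcomp Require Import all_classical all_reals all_analysis.
From mathcomp Require Import ring lra.

Set Implicit Arguments.
Unset Strict Implicit.
Unset Printing Implicit Defensive.

Import Order.TTheory GRing.Theory Num.Theory.
Import numFieldNormedType.Exports.
Local Open Scope classical_set_scope.
Local Open Scope ring_scope.

Lemma lipschitz_continuous (R : realType) (V W : normedModType R) (f : V -> W)
    (C : R) :
  (forall x y, `|f x - f y| <= C * `|x - y|) -> continuous f.
Proof.
move=> fC x; apply/cvgrPdist_lt => e e0.
have C0 : 0 < `|C| + 1 by rewrite ltr_wpDl.
near=> y; rewrite (le_lt_trans (fC x y))//.
rewrite (@le_lt_trans _ _ ((`|C| + 1) * `|x - y|))//.
  by rewrite ler_wpM2r// (le_trans (ler_norm C))// lerDl.
rewrite -ltr_pdivlMl// mulrC; near: y.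
have eC : 0 < e / (`|C| + 1) by rewrite divr_gt0.
exact: (cvgr_dist_lt id x cvg_id _ eC).
Unshelve. all: by end_near. Qed.

(** * Inner products and projections *)

Section inner_product.
Context {R : realType} {V : hilbertType R}.
Implicit Types (x y z : V) (a : R).

Lemma innerDl x y z : inner (x + y) z = inner x z + inner y z.
Proof. by rewrite -[x in LHS]scale1r innerPl mul1r. Qed.

Lemma inner0l z : inner (0 : V) z = 0.
Proof. by apply: (addIr (inner 0 z)); rewrite -innerDl !add0r. Qed.

Lemma innerZl a x z : inner (a *: x) z = a * inner x z.
Proof. by rewrite -[a *: x]addr0 innerPl inner0l addr0. Qed.

Lemma innerNl x z : inner (- x) z = - inner x z.
Proof. by rewrite -scaleN1r innerZl mulN1r. Qed.

Lemma innerBl x y z : inner (x - y) z = inner x z - inner y z.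
Proof. by rewrite innerDl innerNl. Qed.

Lemma innerDr x y z : inner z (x + y) = inner z x + inner z y.
Proof. by rewrite !(innerC z) innerDl. Qed.

Lemma inner0r z : inner z (0 : V) = 0.
Proof. by rewrite innerC inner0l. Qed.

Lemma innerZr a x z : inner z (a *: x) = a * inner z x.
Proof. by rewrite !(innerC z) innerZl. Qed.

Lemma innerNr x z : inner z (- x) = - inner z x.
Proof. by rewrite !(innerC z) innerNl. Qed.

Lemma innerBr x y z : inner z (x - y) = inner z x - inner z y.
Proof. by rewrite innerDr innerNr. Qed.

Definition innerE :=
  (innerBl, innerBr, innerDl, innerDr, innerZl, innerZr, innerNl, innerNr).

Lemma inner_suml (I : Type) (s : seq I) (F : I -> V) z :
  inner (\sum_(i <- s) F i) z = \sum_(i <- s) inner (F i) z.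
Proof.
by apply: (big_morph (inner^~ z)) => [x y|]; [exact: innerDl|exact: inner0l].
Qed.

Lemma inner_sumr (I : Type) (s : seq I) (F : I -> V) z :
  inner z (\sum_(i <- s) F i) = \sum_(i <- s) inner z (F i).
Proof. by rewrite innerC inner_suml; apply: eq_bigr => i _; exact: innerC. Qed.

Lemma inner_eq0 x : inner x x = 0 -> x = 0.
Proof. by rewrite innerxx => /eqP; rewrite sqrf_eq0 normr_eq0 => /eqP. Qed.

Lemma cauchy_schwarz x y : `|inner x y| <= `|x| * `|y|.
Proof.
rewrite -ler_sqr ?nnegrE ?mulr_ge0// exprMn real_normK ?num_real//.
have [->|y0] := eqVneq y 0; first by rewrite inner0r expr0n mulr_ge0 ?sqr_ge0.
have N0 : 0 < inner y y by rewrite innerxx exprn_gt0 ?normr_gt0.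
have : 0 <= inner (inner y y *: x - inner x y *: y)
                  (inner y y *: x - inner x y *: y).
  by rewrite innerxx sqr_ge0.
rewrite -!innerxx !innerE (innerC y x) => H.
rewrite -subr_ge0 -(pmulr_rge0 _ N0); apply: (le_trans H).
by rewrite le_eqVlt; apply/orP; left; apply/eqP; ring.
Qed.

Lemma inner_continuous z : continuous (inner^~ z : V -> R^o).
Proof.
apply: (@lipschitz_continuous _ _ _ _ `|z|) => x y.
by rewrite -innerBl mulrC; exact: cauchy_schwarz.
Qed.

End inner_product.

Section subspace.
Context {R : realType} {V : hilbertType R}.

Lemma subspaceP (M : set V) : submod_closed [in M] <->
  M 0 /\ forall (a : R) u v, M u -> M v -> M (a *: u + v).
Proof.
split=> [[]|[M0 MP]].
  by rewrite !inE => M0 MP; split=> // a u v Mu Mv; have := MP a u v; rewrite !inE; exact.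
by split=> [|a u v]; rewrite !inE //; exact: MP.
Qed.

Lemma subspaceD (M : set V) u v :
  submod_closed [in M] -> M u -> M v -> M (u + v).
Proof. by move=> /subspaceP[_ +] Mu Mv => /(_ 1 _ _ Mu Mv); rewrite scale1r. Qed.

Lemma subspaceZ (M : set V) a u : submod_closed [in M] -> M u -> M (a *: u).
Proof. by move=> /subspaceP[M0 +] Mu => /(_ a _ _ Mu M0); rewrite addr0. Qed.

Lemma subspaceB (M : set V) u v :
  submod_closed [in M] -> M u -> M v -> M (u - v).
Proof.
by move=> sM Mu Mv; rewrite -scaleN1r; apply: subspaceD => //; exact: subspaceZ.
Qed.

(** The bound is on the squared distance because that is what the parallelogram law yields for
    minimizing sequences. *)
Lemma cvg_harmonic_cauchy (u : V^nat) (C : R) :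
  (forall n m, `|u n - u m| ^+ 2 <= C * (n.+1%:R^-1 + m.+1%:R^-1)) ->
  cvg (u @ \oo).
Proof.
move=> uC; apply: cauchy_cvg; apply: cauchy_exP => e e0.
have C0 : 0 <= C.
  have := le_trans (sqr_ge0 _) (uC 0%N 0%N).
  by rewrite invr1 pmulr_lge0// addr_gt0.
have C1 : 0 < 2 * C + 1 by rewrite ltr_wpDl ?mulr_ge0.
(* Two reciprocals below this threshold add up to at most [e ^+ 2] after multiplication by [C]; the
   extra 1 keeps the denominator positive when [C] is 0. *)
have d0 : 0 < e ^+ 2 / (2 * C + 1) by rewrite divr_gt0 ?exprn_gt0.
have [N _ HN] := near_infty_natSinv_lt (PosNum d0).
exists (u N); exists N => // n /= Nn.
rewrite -ball_normE /ball_ /= -ltr_sqr ?nnegrE ?(ltW e0)//.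
rewrite (le_lt_trans (uC _ _))//.
have := HN N (leqnn N); have := HN n Nn; rewrite /= !ltr_pdivlMr//.
have : 0 < n.+1%:R^-1 :> R by rewrite invr_gt0.
have : 0 < N.+1%:R^-1 :> R by rewrite invr_gt0.
move: n.+1%:R^-1 N.+1%:R^-1 => a b b0 a0 aC bC; lra.
Qed.

Lemma exists_minimizer (M : set V) (x : V) :
    submod_closed [in M] -> closed M ->
  exists2 p, M p & forall m, M m -> `|x - p| ^+ 2 <= `|x - m| ^+ 2.
Proof.
move=> sM cM; have M0 := (subspaceP _).1 sM.
pose S := [set `|x - m| ^+ 2 | m in M].
have Slb : lbound S 0 by move=> _ [m _ <-]; rewrite sqr_ge0.
have hS : has_inf S by split; [exists (`|x - 0| ^+ 2); exists 0 => //; case: M0|exists 0].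
have infS m : M m -> inf S <= `|x - m| ^+ 2.
  by move=> Mm; apply: ge_inf; [exists 0|exists m].
have /choice[p pP] (n : nat) : exists p, M p /\ `|x - p| ^+ 2 < inf S + n.+1%:R^-1.
  have n0 : 0 < n.+1%:R^-1 :> R by rewrite invr_gt0.
  by have [_ [p Mp <-] ?] := inf_adherent n0 hS; exists p.
have cp : cvg (p @ \oo).
  apply: (@cvg_harmonic_cauchy p 2) => n m.
  have [Mn pn] := pP n; have [Mm pm] := pP m.
  (* The midpoint lies in [M], so its squared distance to [x] is at least the infimum; the
     parallelogram law then gives the constant 2. *)
  have := infS (2^-1 *: (p n + p m)) (subspaceZ _ sM (subspaceD sM Mn Mm)).
  move: pn pm; rewrite -!innerxx !innerE !(innerC _ x) (innerC (p m) (p n)).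
  by move: n.+1%:R^-1 m.+1%:R^-1 => a b; lra.
have Ml : M (lim (p @ \oo)).
  by apply: (closed_cvg M cM _ _ cp); apply: nearW => n; case: (pP n).
exists (lim (p @ \oo)) => // m Mm; apply: le_trans (infS m Mm).
have dcvg : `|x - p n| ^+ 2 @[n --> \oo] --> `|x - lim (p @ \oo)| ^+ 2.
  have nc : `|x - p n| @[n --> \oo] --> `|x - lim (p @ \oo)|.
    by apply: cvg_norm; apply: cvgB; [exact: cvg_cst|exact: cp].
  by rewrite expr2; under eq_fun do rewrite expr2; exact: cvgM.
have icvg : (inf S + n.+1%:R^-1 : R) @[n --> \oo] --> inf S.
  rewrite -[X in _ --> X]addr0; apply: cvgD; first exact: cvg_cst.
  exact: cvg_harmonic.
apply: ler_cvg_to dcvg icvg _; apply: nearW => n; case: (pP n) => _ /ltW; exact.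
Qed.

Lemma projection_theorem (M : set V) (x : V) :
    submod_closed [in M] -> closed M ->
  exists2 p, M p & forall m, M m -> inner (x - p) m = 0.
Proof.
move=> sM cM; have [p Mp pmin] := exists_minimizer x sM cM.
exists p => // m Mm; have [->|m0] := eqVneq m 0; first by rewrite inner0r.
set y := x - p; set c := inner y m.
have N0 : 0 < inner m m by rewrite innerxx exprn_gt0 ?normr_gt0.
(* Moving [p] by the best multiple of [m] lowers the squared distance by [c ^+ 2 / inner m m], so
   minimality forces [c] to be 0. *)
have := pmin _ (subspaceD sM Mp (subspaceZ (c / inner m m) sM Mm)).
rewrite opprD addrA -/y -!innerxx; clearbody y; rewrite !innerE (innerC m) -/c => H.
have : c * c / inner m m <= 0.
  move: H; rewrite divfK ?gt_eqF// (mulrAC c c).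
  by move: (_ / _ * c) => t; lra.
rewrite pmulr_lle0 ?invr_gt0// -expr2 => c2; apply/eqP.
by rewrite -sqrf_eq0 eq_le c2 sqr_ge0.
Qed.

End subspace.

(** * Norms on the Hilbert product *)

Section hprod_theory.
Context {R : realType} {V W : hilbertType R}.
Implicit Types x y : hprod V W.

Lemma hprod_innerE x y : inner x y = inner x.1 y.1 + inner x.2 y.2.
Proof. by []. Qed.

Lemma hprod_normE2 x : `|x| ^+ 2 = `|x.1| ^+ 2 + `|x.2| ^+ 2.
Proof. by rewrite -!innerxx. Qed.

Lemma le_hprod_fst x : `|x.1| <= `|x|.
Proof. by rewrite -ler_sqr ?nnegrE// hprod_normE2 lerDl sqr_ge0. Qed.

Lemma le_hprod_snd x : `|x.2| <= `|x|.
Proof. by rewrite -ler_sqr ?nnegrE// hprod_normE2 lerDr sqr_ge0. Qed.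

Lemma hprod_norm_le x : `|x| <= `|x.1| + `|x.2|.
Proof.
rewrite -ler_sqr ?nnegrE ?addr_ge0// hprod_normE2 sqrrD lerD2r lerDl.
by rewrite mulrn_wge0// mulr_ge0.
Qed.

End hprod_theory.

(** * Bounded inverse theorem *)

Section bounded_below.
Context {R : realType} {V W : hilbertType R} (T : {linear V -> W}).

Lemma subspace_range : submod_closed [in range T].
Proof.
apply/subspaceP; split; first by exists 0 => //; rewrite linear0.
by move=> a _ _ [u _ <-] [v _ <-]; exists (a *: u + v) => //; rewrite linearP.
Qed.

Let graph : set (hprod V W) := [set x | x.2 = T x.1].

Let subspace_graph : submod_closed [in graph].
Proof.
apply/subspaceP; split=> [|a u v]; rewrite /graph /=; first by rewrite linear0.
by move=> -> ->; rewrite linearP.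
Qed.

Context (Tb : bounded_operator T).

Let closed_graph : closed graph.
Proof.
have [M TM] := Tb.
pose f (x : hprod V W) := x.2 - T x.1.
have cf : continuous f.
  apply: (@lipschitz_continuous _ _ _ _ (1 + `|M|)) => x y; rewrite /f.
  have -> : x.2 - T x.1 - (y.2 - T y.1) = (x - y).2 - T (x - y).1.
    have -> : (x - y).1 = x.1 - y.1 by [].
    have -> : (x - y).2 = x.2 - y.2 by [].
    by rewrite (linearB T) !opprB addrACA [RHS]addrACA (addrC (- T x.1)).
  rewrite (le_trans (ler_normB _ _))// mulrDl mul1r lerD ?le_hprod_snd//.
  rewrite (le_trans (TM _))// (@le_trans _ _ (`|M| * `|(x - y).1|))//.
    by rewrite ler_wpM2r// ler_norm.
  by rewrite ler_wpM2l// le_hprod_fst.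
have -> : graph = f @^-1` [set 0].
  apply/seteqP; split=> x; rewrite /graph /f /=; first by move=> ->; rewrite subrr.
  exact: subr0_eq.
move/continuous_closedP : cf; apply.
exact/accessible_closed_set1/hausdorff_accessible/norm_hausdorff.
Qed.

Context (Tcl : closed (range T)).

(* The values of the adjoint on the range of T, without constructing it. *)
Let adjoint z v := range T z /\ forall w, inner z (T w) = inner v w.

(* Banach-Steinhaus, applied to the functionals [inner z] for [z] in the range
   of T whose image by the adjoint has norm at most 1. *)
Let adjoint_bounded_below :
  exists2 C : R, 0 <= C & forall z v, adjoint z v -> `|z| <= C * `|v|.
Proof.
pose F : set (W -> R^o) := [set f | exists z, [/\ range T z,
  forall w, `|inner z (T w)| <= `|w| & f = inner z]].
have Flin f : F f -> bounded_fun_norm f /\ linear f.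
  move=> [z [_ _ ->]]; split=> [r|a x y]; last by rewrite innerDr innerZr.
  exists (`|z| * r) => x xr.
  by rewrite (le_trans (cauchy_schwarz _ _))// ler_wpM2l.
have Fpt : pointwise_bounded F.
  (* With [T w] the projection of [y] on the range, [inner z y] equals [inner z (T w)] for every [z]
     in the range, whence the bound [|w|]. *)
  move=> y; have [_ [w _ <-] wP] := projection_theorem y subspace_range Tcl.
  exists `|w| => _ [z [Rz zP ->]]; have := wP _ Rz.
  by rewrite innerBl => /eqP; rewrite subr_eq0 => /eqP; rewrite innerC => ->;
    rewrite innerC.
have [C FC] := Banach_Steinhauss Flin Fpt 1.
have C0 : 0 <= C.
  apply: (le_trans (normr_ge0 _)); apply: (FC (inner 0) _ 0); rewrite ?normr0//.
  exists 0; split => //; first by case/subspaceP : subspace_range.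
  by move=> w; rewrite inner0l normr0.
exists C => // z v [Rz zv]; have [v0|v0] := eqVneq v 0.
  have [w _ wz] := Rz; have := zv w.
  by rewrite v0 inner0l wz => /inner_eq0 ->; rewrite !normr0 mulr0.
have v0' : 0 < `|v| by rewrite normr_gt0.
have [->|z0] := eqVneq z 0; first by rewrite normr0 mulr_ge0.
have z0' : 0 < `|z| by rewrite normr_gt0.
(* Scaling [z] by [|v|^-1] puts its functional in the family; at the unit vector along [z] this
   functional takes the value [|z| / |v|]. *)
have := FC (inner (`|v|^-1 *: z)) _ (`|z|^-1 *: z).
rewrite normrZ normfV normr_id mulVf ?gt_eqF// => /(_ _ (lexx _)) H.
rewrite mulrC -ler_pdivrMl//.
have <- : `|inner (`|v|^-1 *: z) (`|z|^-1 *: z)| = `|v|^-1 * `|z|.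
  rewrite innerZl innerZr innerxx expr2 mulKf ?gt_eqF//.
  by rewrite ger0_norm// mulr_ge0// invr_ge0.
apply: H; exists (`|v|^-1 *: z); split=> [|w|//].
  exact: subspaceZ subspace_range Rz.
rewrite innerZl zv normrM normfV normr_id ler_pdivrMl//.
exact: cauchy_schwarz.
Qed.

(** The image of the range of T under the adjoint. *)
Let M := [set v | exists z, adjoint z v].

Let adjointP a z v z' v' : adjoint z v -> adjoint z' v' ->
  adjoint (a *: z + z') (a *: v + v').
Proof.
move=> [Rz zv] [Rz' zv']; split=> [|w]; last by rewrite !innerPl zv zv'.
exact: (((subspaceP _).1 subspace_range).2).
Qed.

(** If adjoint values converge, their preimages in the range of T form a Cauchy sequence by
    [adjoint_bounded_below], and the defining identity passes to the limit. *)
Let closed_M : closed M.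
Proof.
have [C C0 HC] := adjoint_bounded_below.
move=> v vM.
have /choice[u uP] (n : nat) : exists u : W * V,
    adjoint u.1 u.2 /\ `|v - u.2| < n.+1%:R^-1.
  have n0 : 0 < n.+1%:R^-1 :> R by rewrite invr_gt0.
  have [w [[z zw] vw]] := vM _ (nbhsx_ballx v _ n0).
  by exists (z, w); split=> //; move: vw; rewrite -ball_normE.
have cz : cvg ((fst \o u) @ \oo).
  (* The factor 2 comes from (a + b)^2 <= 2 (a^2 + b^2), where a and b are distances to [v]; a
     reciprocal is at most 1, so it also bounds the square of the distance below it. *)
  apply: (@cvg_harmonic_cauchy _ _ _ (C ^+ 2 * 2)) => n m /=.
  have [un vn] := uP n; have [um vm] := uP m.
  have := adjointP (-1) um un; rewrite !scaleN1r !(addrC (- _)) => /HC.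
  rewrite -ler_sqr ?nnegrE ?mulr_ge0// exprMn => /le_trans; apply.
  rewrite -mulrA ler_wpM2l ?sqr_ge0//.
  have : `|(u n).2 - (u m).2| <= `|v - (u n).2| + `|v - (u m).2|.
    by rewrite (distrC v (u n).2) (le_trans _ (ler_normD _ _))// addrA subrK.
  have : n.+1%:R^-1 <= 1 :> R by rewrite invf_le1// ler1n.
  have : m.+1%:R^-1 <= 1 :> R by rewrite invf_le1// ler1n.
  move: vn vm (normr_ge0 ((u n).2 - (u m).2)).
  move: (normr_ge0 (v - (u n).2)) (normr_ge0 (v - (u m).2)).
  move: `|v - (u n).2| `|v - (u m).2| `|(u n).2 - _| n.+1%:R^-1 m.+1%:R^-1.
  move=> a b c n' m' a0 b0 an bm c0 m1 n1 cab.
  apply: (@le_trans _ _ ((a + b) ^+ 2)); first by rewrite ler_sqr ?nnegrE ?addr_ge0.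
  apply: (@le_trans _ _ (2 * (a ^+ 2 + b ^+ 2))).
    by have := sqr_ge0 (a - b); rewrite sqrrB sqrrD !mulr2n; lra.
  rewrite ler_pM2l// lerD// expr2.
    by rewrite -[leRHS]mul1r ler_pM// ltW// (lt_le_trans an).
  by rewrite -[leRHS]mul1r ler_pM// ltW// (lt_le_trans bm).
exists (lim ((fst \o u) @ \oo)); split.
  apply: (closed_cvg _ Tcl _ _ cz); apply: nearW => n /=.
  by case: (uP n) => -[].
move=> w.
have c2 : (snd \o u) @ \oo --> v.
  apply/cvgrPdist_lt => e e0.
  have := near_infty_natSinv_lt (PosNum e0); apply: filterS => n /= ne.
  by case: (uP n) => _ /lt_trans; exact.
have c1 : inner ((u n).1) (T w) @[n --> \oo] -->
    (inner (lim ((fst \o u) @ \oo)) (T w) : R^o).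
  exact: (cvg_comp _ _ cz (@inner_continuous _ _ (T w) _)).
have c3 : inner ((u n).2) w @[n --> \oo] --> (inner v w : R^o).
  exact: (cvg_comp _ _ c2 (@inner_continuous _ _ w v)).
have eqf : (fun n => inner (u n).1 (T w)) = (fun n => inner (u n).2 w).
  by apply: funext => n; case: (uP n) => -[].
rewrite eqf in c1.
exact: (cvg_unique (@norm_hausdorff _ _) c1 c3).
Qed.

(** A residual [r] orthogonal to [M] is shown to vanish: a regularized least-squares problem yields
    a [w] in [M] with T*(T r - T w) = w, and orthogonality of [r] and [w] then forces T r = 0. *)
Let MT : injective T -> M = setT.
Proof.
move=> Ti.
have sM : submod_closed [in M].
  apply/subspaceP; split.
    exists 0; split; first by case/subspaceP : subspace_range.
    by move=> w; rewrite !inner0l.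
  move=> a u v [z zu] [z' zv]; exists (a *: z + z'); exact: adjointP.
apply/seteqP; split=> // v _.
have [p Mp pP] := projection_theorem v sM closed_M.
set r := v - p in pP.
(* Projecting [(0, T r)] on the graph minimizes |w|^2 + |T r - T w|^2; orthogonality to [(k, T k)]
   is the equation [adj] below. *)
have [[w Tw] /= TwE wP] :=
  projection_theorem ((0, T r) : hprod V W) subspace_graph closed_graph.
have {}TwE : Tw = T w by [].
have adj : adjoint (T r - T w) w.
  split=> [|k]; first by exists (r - w) => //; rewrite linearB.
  have := wP (k, T k) erefl; rewrite hprod_innerE /= TwE sub0r innerNl addrC.
  by move/eqP; rewrite subr_eq0 => /eqP.
have rw : inner r w = 0 by apply: pP; exists (T r - T w).
have : inner (T r - T w) (T r - T w) + inner w w = 0.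
  by rewrite -[in X in inner _ X]linearB (adj.2 (r - w)) innerBr (innerC w r) rw; ring.
rewrite !innerxx => /eqP; rewrite paddr_eq0 ?sqr_ge0// !sqrf_eq0 !normr_eq0.
move=> /andP[/eqP Trw /eqP w0].
have r0 : r = 0.
  by apply: Ti; move: Trw; rewrite w0 !(linear0 T) subr0.
by rewrite -(subrK p v) -/r r0 add0r.
Qed.

(** Each [v] is an adjoint value of some [z] in the range with |z| <= C |v|, so |v|^2 = <z, T v> <=
    C |v| |T v|. *)
Lemma bounded_below : injective T ->
  exists2 C : R, 0 <= C & forall v, `|v| <= C * `|T v|.
Proof.
move=> /MT MT'; have [C C0 HC] := adjoint_bounded_below.
exists C => // v; have [z zv] : M v by rewrite MT'.
have [->|v0] := eqVneq v 0; first by rewrite normr0 mulr_ge0.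
have v0' : 0 < `|v| by rewrite normr_gt0.
rewrite -(ler_pM2r v0') -expr2 -innerxx -(zv.2 v) (le_trans (ler_norm _))//.
rewrite (le_trans (cauchy_schwarz _ _))// mulrAC ler_wpM2r//.
exact: HC.
Qed.

End bounded_below.

(** * Estimates for the operator norm *)

Section operator_norm.
Context {R : realType} {V W : hilbertType R}.
Implicit Types f : {linear V -> W}.

(** Boundedness makes the supremum a genuine upper bound rather than the default value of [sup]. *)
Lemma le_operator_norm f v :
  bounded_operator f -> `|f v| <= operator_norm f * `|v|.
Proof.
move=> [M fM]; have [->|v0] := eqVneq v 0; first by rewrite linear0 !normr0 mulr0.
have v0' : 0 < `|v| by rewrite normr_gt0.
rewrite -ler_pdivrMr//; apply: ub_le_sup.
  exists `|M| => _ [x /= x1 <-]; rewrite (le_trans (fM _))//.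
  rewrite (@le_trans _ _ (`|M| * `|x|)) ?ler_wpM2r ?ler_norm//.
  by rewrite -[leRHS]mulr1 ler_wpM2l.
exists (`|v|^-1 *: v) => /=.
  by rewrite normrZ normfV normr_id mulVf ?gt_eqF.
by rewrite linearZ normrZ normfV normr_id mulrC.
Qed.

Lemma operator_norm_le f C :
  (forall v, `|v| <= 1 -> `|f v| <= C) -> 0 <= operator_norm f <= C.
Proof.
move=> fC; have f0 : [set `|f x| | x in [set x | `|x| <= 1]] 0.
  by exists 0; rewrite /= ?linear0 ?normr0.
have ubC : ubound [set `|f x| | x in [set x | `|x| <= 1]] C.
  by move=> _ [v v1 <-]; exact: fC.
apply/andP; split; last by apply: ge_sup => //; exists 0.
by apply: ub_le_sup => //; exists C.
Qed.

End operator_norm.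

(** * Dirac structures *)

Section dirac_theory.
Context {R : realType} {Z : hilbertType R}.
Implicit Types (D : set (hprod Z Z)) (z m : hprod Z Z).

Lemma power_pairing_inner z m :
  power_pairing z m = inner z ((m.2, m.1) : hprod Z Z).
Proof. by rewrite /power_pairing hprod_innerE (innerC m.1). Qed.

Lemma power_pairingC z m : power_pairing z m = power_pairing m z.
Proof. by rewrite /power_pairing addrC. Qed.

Lemma power_pairingBl z z' m :
  power_pairing (z - z') m = power_pairing z m - power_pairing z' m.
Proof. by rewrite !power_pairing_inner innerBl. Qed.

Lemma le_power_pairing z m : `|power_pairing z m| <= `|z| * `|m|.
Proof.
rewrite power_pairing_inner; have -> : `|m| = `|(m.2, m.1) : hprod Z Z|.
  by apply/eqP; rewrite -(@eqrXn2 _ 2)// !hprod_normE2 addrC.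
exact: cauchy_schwarz.
Qed.

Lemma dirac_pairing D z m :
  dirac_structure D -> D z -> D m -> power_pairing z m = 0.
Proof. by move=> [_ DE]; rewrite [X in X z -> _]DE; exact. Qed.

Lemma diracP D z :
  dirac_structure D -> (forall m, D m -> power_pairing z m = 0) -> D z.
Proof. by move=> [_ DE] zD; rewrite DE. Qed.

Lemma dirac_closed D : dirac_structure D -> closed D.
Proof.
move=> [_ DE]; have -> : D = \bigcap_(m in D)
    ((inner^~ ((m.2, m.1) : hprod Z Z) : hprod Z Z -> R^o) @^-1` [set 0]).
  rewrite {1}DE; apply/seteqP; split=> z /= zD m Dm.
    by rewrite /= -power_pairing_inner; exact: zD.
  by rewrite power_pairing_inner; exact: zD.
apply: closed_bigI => m Dm.
move/continuous_closedP : (@inner_continuous _ _ ((m.2, m.1) : hprod Z Z)); apply.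
exact/accessible_closed_set1/hausdorff_accessible/norm_hausdorff.
Qed.

(** The pairing of [m] with itself is twice the inner product of flow and effort, so these are
    orthogonal and Pythagoras applies. *)
Lemma dirac_norm_sum D m : dirac_structure D -> D m -> `|m.1 + m.2| = `|m|.
Proof.
move=> dD Dm; have := dirac_pairing dD Dm Dm.
rewrite /power_pairing -mulr2n => /eqP; rewrite mulrn_eq0/= => /eqP m12.
apply/eqP; rewrite -(@eqrXn2 _ 2)// hprod_normE2 -!innerxx !innerE.
by rewrite (innerC m.2) m12 addr0 add0r.
Qed.

Lemma dirac_norm_diff D m : dirac_structure D -> D m -> `|m.1 - m.2| = `|m|.
Proof.
move=> dD Dm; have := dirac_pairing dD Dm Dm.
rewrite /power_pairing -mulr2n => /eqP; rewrite mulrn_eq0/= => /eqP m12.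
apply/eqP; rewrite -(@eqrXn2 _ 2)// hprod_normE2 -!innerxx !innerE.
by rewrite (innerC m.2) m12 subr0 sub0r opprK.
Qed.

(* If [p] is the orthogonal projection of [(s, 0)] on [D], then [(s, 0) - p] is
   orthogonal to [D], so that exchanging its components puts it in [D]. *)
Lemma dirac_decomposition D s : dirac_structure D ->
  exists p, D p /\ D (- p.2, s - p.1).
Proof.
move=> dD; have [p Dp pP] :=
  projection_theorem ((s, 0) : hprod Z Z) dD.1 (dirac_closed dD).
exists p; split=> //; apply: (diracP dD) => m Dm; have := pP m Dm.
by rewrite hprod_innerE /power_pairing /= sub0r addrC (innerC m.1).
Qed.

Lemma dirac_sum_surj D s : dirac_structure D -> exists2 m, D m & m.1 + m.2 = s.
Proof.
move=> dD; have [p [Dp Dq]] := dirac_decomposition s dD.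
exists (p + (- p.2, s - p.1)); first exact: (subspaceD dD.1).
by rewrite /= addrA subrK addrC subrK.
Qed.

Lemma dirac_diff_surj D s : dirac_structure D -> exists2 m, D m & m.1 - m.2 = s.
Proof.
move=> dD; have [p [Dp Dq]] := dirac_decomposition s dD.
exists (p - (- p.2, s - p.1)); first exact: (subspaceB dD.1).
by rewrite /= opprK opprB addrACA subrr addr0 addrC subrK.
Qed.

Lemma dirac_sum_inj D m m' : dirac_structure D -> D m -> D m' ->
  m.1 + m.2 = m'.1 + m'.2 -> m = m'.
Proof.
move=> dD Dm Dm' mm'; have := dirac_norm_sum dD (subspaceB dD.1 Dm Dm').
have -> : (m - m').1 + (m - m').2 = (m.1 + m.2) - (m'.1 + m'.2).
  by rewrite opprD addrACA.
by rewrite mm' subrr normr0 => /esym/normr0_eq0/subr0_eq.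
Qed.

(** * Modulation and the pairing gap *)

Let pack_linear (f : Z -> hprod Z Z) (lf : linear f) : {linear Z -> hprod Z Z} :=
  HB.pack f (GRing.isLinear.Build _ _ _ _ _ lf).

Lemma dirac_sum_section D : dirac_structure D ->
  exists T : {linear Z -> hprod Z Z},
    forall s, D (T s) /\ (T s).1 + (T s).2 = s.
Proof.
move=> dD; have /choice[f fP] (s : Z) : exists m, D m /\ m.1 + m.2 = s.
  by have [m ? ?] := dirac_sum_surj s dD; exists m.
have lf : linear f.
  move=> a u v; have [Du uE] := fP u; have [Dv vE] := fP v.
  have [Dw wE] := fP (a *: u + v).
  apply: (dirac_sum_inj dD) => //; first exact: ((subspaceP _).1 dD.1).2.
  by rewrite wE -[in LHS]uE -[in LHS]vE scalerDr addrACA.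
by exists (pack_linear lf).
Qed.

Definition pairing_gap_le D D' (eps : R) := forall m m', D m -> D' m' ->
  `|power_pairing m m'| <= eps * (`|m| * `|m'|).

(** Writing [m = T x w], the vector [T x' w] lies in [D x'] and pairs to 0 with [m']. Only the small
    difference [T x w - T x' w] contributes, and the bounded inverse theorem bounds [w] by [m]. *)
Lemma modulated_dirac_gap (X : topologicalType) (D : X -> set (hprod Z Z)) :
  modulated_dirac_structure D -> forall x (eps : R), 0 < eps ->
  \forall x' \near x, pairing_gap_le (D x) (D x') eps.
Proof.
move=> [dD [W DW]] x e e0; have [U [T [oU Ux bT bijT cT]]] := DW x.
have rangeT y : U y -> D y = range (T y).
  move=> /bijT[TD _ DT]; apply/seteqP; split=> [m /DT//|_ [w _ <-]].
  exact: TD.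
have Tinj : injective (T x).
  by move=> u v; have [_ + _] := bijT x Ux; apply; rewrite inE.
have Tcl : closed (range (T x)) by rewrite -rangeT//; exact: dirac_closed.
have [C C0 HC] := bounded_below (bT x Ux) Tcl Tinj.
have C1 : 0 < C + 1 by rewrite ltr_wpDl.
have eC : 0 < e / (C + 1) by rewrite divr_gt0.
have /cvgrPdist_lt/(_ _ eC) nT := cT x Ux.
have nU : \forall x' \near x, U x' by apply: open_nbhs_nbhs; split.
near=> x'.
have Ux' : U x' by near: x'.
have Te : `|0 - operator_norm (T x' \- T x)| < e / (C + 1) by near: x'; exact: nT.
move=> m m'; rewrite [D x]rangeT// => -[w _ <-] Dm'.
have bB : bounded_operator (T x' \- T x).
  have [[M HM] [N HN]] := (bT x Ux, bT x' Ux'); exists (N + M) => v.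
  by rewrite (le_trans (ler_normB _ _))// mulrDl lerD.
have Dw : D x' (T x' w) by rewrite rangeT//; exists w.
have -> : power_pairing (T x w) m' = power_pairing (T x w - T x' w) m'.
  by rewrite power_pairingBl (dirac_pairing (dD x') Dw Dm') subr0.
rewrite (le_trans (le_power_pairing _ _))// mulrA ler_wpM2r//.
rewrite distrC (le_trans (le_operator_norm w bB))//.
rewrite sub0r normrN in Te.
rewrite (@le_trans _ _ (e / (C + 1) * (C * `|T x w|)))//.
  rewrite (@le_trans _ _ (e / (C + 1) * `|w|))//.
    by rewrite ler_wpM2r// (le_trans (ler_norm _))// ltW.
  by rewrite ler_wpM2l// ltW.
rewrite mulrA ler_wpM2r// -mulrA ler_piMr ?(ltW e0)//.
by rewrite ler_pdivrMl// mulr1 lerDl.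
Unshelve. all: by end_near. Qed.

(** [T y' s] and [T y s] have the same component sum, so they differ by some [(p, - p)]. Pairing
    [T y s] with the element of [D y'] of component difference [p] gives |p|^2, while the gap bounds
    it by a small multiple of |s| |p|. *)
Lemma gap_modulated_dirac (X : topologicalType) (D : X -> set (hprod Z Z)) :
  (forall x, dirac_structure (D x)) ->
  (forall x (eps : R), 0 < eps ->
    \forall x' \near x, pairing_gap_le (D x) (D x') eps) ->
  modulated_dirac_structure D.
Proof.
move=> dD gD; split=> //; exists Z => x.
have /choice[T TP] (y : X) := dirac_sum_section (dD y).
have normT y s : `|T y s| = `|s|.
  by have [Ds sE] := TP y s; rewrite -(dirac_norm_sum (dD y) Ds) sE.
exists setT, T; split=> //; first exact: openT.
- by move=> y _; exists 1 => s; rewrite normT mul1r.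
- move=> y _; split=> [s _|u v _ _ uv|m Dm].
  + by case: (TP y s).
  + by rewrite -(TP y u).2 uv (TP y v).2.
  + exists (m.1 + m.2) => //; have [Ds sE] := TP y (m.1 + m.2).
    exact: (dirac_sum_inj (dD y)).
- move=> y _; apply/cvgrPdist_lt => e e0; near=> y'.
  (* Each of the two components of the difference is at most [e / 4], leaving [e / 2] for the
     operator norm and a strict inequality at the end. *)
  have gap : pairing_gap_le (D y) (D y') (e / 4).
    by near: y'; apply: gD; rewrite divr_gt0.
  have /operator_norm_le/andP[? le_e] s : `|s| <= 1 -> `|(T y' \- T y) s| <= e / 2.
    move=> s1; have [Ds sE] := TP y s; have [Ds' sE'] := TP y' s.
    have [m' Dm' m'E] := dirac_diff_surj ((T y' s).1 - (T y s).1) (dD y').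
    have pE : (T y' s).2 - (T y s).2 = - ((T y' s).1 - (T y s).1).
      apply/eqP; rewrite -addr_eq0 addrC; apply/eqP.
      by rewrite addrACA sE' -opprD sE subrr.
    have pair : power_pairing (T y s) m' = `|(T y' s).1 - (T y s).1| ^+ 2.
      have -> : power_pairing (T y s) m' = - power_pairing (T y' s - T y s) m'.
        by rewrite power_pairingBl (dirac_pairing (dD y') Ds' Dm') sub0r opprK.
      rewrite /power_pairing /= pE innerNr -innerxx.
      by rewrite -[X in _ = inner X _]m'E innerBl (innerC m'.2) opprB.
    have := gap _ _ Ds Dm'; rewrite pair normT -(dirac_norm_diff (dD y') Dm') m'E.
    set p := (T y' s).1 - _; rewrite ger0_norm// => pp.
    have {}pp : `|p| <= e / 4.
      have [p0|p0] := eqVneq `|p| 0; first by rewrite p0 divr_ge0// ltW.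
      rewrite -(@ler_pM2r _ `|p|) ?lt_def ?p0 ?normr_ge0// -expr2.
      by rewrite (le_trans pp)// mulrA ler_wpM2r// ler_piMr// divr_ge0// ltW.
    rewrite (le_trans (hprod_norm_le _))//=.
    rewrite pE normrN -/p; lra.
  rewrite sub0r normrN ger0_norm// (le_lt_trans le_e)// ltr_pdivrMr//.
  by rewrite ltr_pMr// ltr1n.
Unshelve. all: by end_near. Qed.

End dirac_theory.

(** * Finite Parseval frames *)

Section frame.
Context {R : realType} {V : hilbertType R}.
Implicit Types (s : seq V) (u v : V).

(** A list [s] whose frame operator is the identity is a Parseval frame; it plays the part of an
    orthonormal basis. *)
Definition frame_operator s v := \sum_(u <- s) inner v u *: u.

Lemma frame_operatorP s a u v :
  frame_operator s (a *: u + v) = a *: frame_operator s u + frame_operator s v.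
Proof.
rewrite /frame_operator scaler_sumr -big_split /=; apply: eq_bigr => w _.
by rewrite innerPl scalerDl scalerA.
Qed.

Lemma frame_operator_sum s (I : Type) (r : seq I) (c : I -> R) (F : I -> V) :
  frame_operator s (\sum_(i <- r) c i *: F i) =
  \sum_(i <- r) c i *: frame_operator s (F i).
Proof.
elim: r => [|i r IH]; last by rewrite !big_cons frame_operatorP IH.
by rewrite !big_nil /frame_operator big1// => u _; rewrite inner0l scale0r.
Qed.

Lemma frame_operator_sym s u v :
  inner (frame_operator s u) v = inner u (frame_operator s v).
Proof.
rewrite /frame_operator inner_suml inner_sumr; apply: eq_bigr => w _.
by rewrite innerZl innerZr (innerC v) mulrC.
Qed.

(* Gram-Schmidt: each step adds the normalized residual of [b], if nonzero. *)
Lemma exists_frame (l : seq V) : exists s,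
  {in s, forall v, frame_operator s v = v} /\
  {in l, forall v, frame_operator s v = v}.
Proof.
elim: l => [|b l [s [ss sl]]]; first by exists [::].
set p := frame_operator s b; pose d := b - p.
have sp : frame_operator s p = p.
  rewrite {1}/p {2}/frame_operator frame_operator_sum; apply: eq_big_seq => u us.
  by rewrite ss.
have [d0|d0] := eqVneq d 0.
  exists s; split=> // v; rewrite inE => /orP[/eqP->|/sl//].
  by move: d0 => /subr0_eq.
have sd : frame_operator s d = 0.
  by rewrite /d addrC -scaleN1r frame_operatorP sp scaleN1r addNr.
have d0' : 0 < `|d| by rewrite normr_gt0.
pose e := `|d|^-1 *: d.
have ee : inner e e = 1.
  by rewrite innerZl innerZr innerxx expr2 mulKf ?gt_eqF// mulVf ?gt_eqF.
(* By symmetry of the frame operator, [e] is then orthogonal to every fixed vector of [s], so adding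
   it keeps those vectors fixed. *)
have se : frame_operator s e = 0.
  rewrite -[e]addr0 frame_operatorP sd scaler0 add0r /frame_operator.
  by rewrite big1// => u _; rewrite inner0l scale0r.
have es u : frame_operator s u = u -> inner u e = 0.
  by move=> <-; rewrite frame_operator_sym se inner0r.
have cE v : frame_operator (e :: s) v = inner v e *: e + frame_operator s v.
  by rewrite /frame_operator big_cons.
have sE v : frame_operator s v = v -> frame_operator (e :: s) v = v.
  by move=> sv; rewrite cE sv es// scale0r add0r.
have eE : frame_operator (e :: s) e = e by rewrite cE ee scale1r se addr0.
exists (e :: s); split=> v; rewrite inE => /orP[/eqP->//|].
- by move=> /ss /sE.
- have -> : b = `|d| *: e + p by rewrite scalerA mulfV ?gt_eqF// scale1r subrK.
  by rewrite frame_operatorP eE sE.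
- by move=> /sl /sE.
Qed.

Lemma finite_dimensional_frame : finite_dimensional V ->
  exists s, forall v, frame_operator s v = v.
Proof.
move=> [n [b bV]]; have [s [_ sb]] := exists_frame (codom b).
exists s => v; have [c ->] := bV v; rewrite frame_operator_sum.
by apply: eq_bigr => i _; rewrite sb// codom_f.
Qed.

Lemma frame_riesz s (f : V -> R) :
  (forall v, frame_operator s v = v) ->
  (forall a u v, f (a *: u + v) = a * f u + f v) ->
  exists k, forall v, f v = inner k v.
Proof.
move=> sP fP; have f0 : f 0 = 0.
  by apply: (addIr (f 0)); have := fP 1 0 0; rewrite scale1r mul1r addr0 add0r => <-.
exists (\sum_(u <- s) f u *: u) => v; rewrite -{1}(sP v) inner_suml.
rewrite /frame_operator; elim: (s) => [|u r IH]; first by rewrite !big_nil.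
by rewrite !big_cons fP IH innerZl (innerC u) mulrC.
Qed.

Lemma frame_norm_le s v : frame_operator s v = v ->
  `|v| <= \sum_(u <- s) `|inner v u| * `|u|.
Proof.
move=> {1}<-; rewrite (le_trans (ler_norm_sum _ _ _))//.
by apply: ler_sum => u _; rewrite normrZ.
Qed.

End frame.

(** Copies of the frame in each factor together form a frame of the product. *)
Lemma hprod_frame (R : realType) (V : hilbertType R) (s : seq V) :
  (forall v, frame_operator s v = v) ->
  exists r : seq (hprod V V), forall v, frame_operator r v = v.
Proof.
move=> sP; exists ([seq (u, 0) | u <- s] ++ [seq (0, u) | u <- s]) => -[v w].
rewrite /frame_operator big_cat !big_map/=.
have E1 : \sum_(u <- s) inner ((v, w) : hprod V V) (u, 0) *: ((u, 0) : hprod V V) =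
    (v, 0).
  rewrite -{2}(sP v) /frame_operator; elim: (s) => [|u r IH]; first by rewrite !big_nil.
  rewrite !big_cons IH hprod_innerE /= inner0r addr0; congr pair => /=.
  by rewrite scaler0 addr0.
have E2 : \sum_(u <- s) inner ((v, w) : hprod V V) (0, u) *: ((0, u) : hprod V V) =
    (0, w).
  rewrite -{2}(sP w) /frame_operator; elim: (s) => [|u r IH]; first by rewrite !big_nil.
  rewrite !big_cons IH hprod_innerE /= inner0r add0r; congr pair => /=.
  by rewrite scaler0 addr0.
by rewrite E1 E2; congr pair; rewrite /= ?addr0 ?add0r.
Qed.

Lemma subspace_power_orthogonal (R : realType) (Z : hilbertType R)
    (M : set (hprod Z Z)) : submod_closed [in power_orthogonal M].
Proof.
apply/subspaceP; split=> [m _|a u v uM vM m Mm].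
  by rewrite power_pairing_inner inner0l.
by rewrite power_pairing_inner innerPl -!power_pairing_inner uM// vM// mulr0 addr0.
Qed.

(** * Interconnection *)

Section interconnection.
Context {R : realType} {Z1 Z2 Zc : hilbertType R}.
Local Notation H1 := (hprod (hprod Z1 Zc) (hprod Z1 Zc)).
Local Notation H2 := (hprod (hprod Z2 Zc) (hprod Z2 Zc)).
Local Notation HH := (hprod (hprod Z1 Z2) (hprod Z1 Z2)).
Implicit Types (m : HH) (fc ec : Zc) (d : H1 * H2).

(** Lifts of [m] to the two structures with shared coupling variables; [ext] goes back by forgetting
    them. *)
Let left m fc ec : H1 := ((m.1.1, fc), (m.2.1, ec)).
Let right m fc ec : H2 := ((m.1.2, fc), (m.2.2, - ec)).
Let ext d : HH := ((d.1.1.1, d.2.1.1), (d.1.2.1, d.2.2.1)).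

(** The coupling variables appear as [(ec, fc)] since the power pairing matches efforts with
    flows. *)
Lemma interconnection_pairing m fc ec d :
  power_pairing (left m fc ec) d.1 + power_pairing (right m fc ec) d.2 =
  power_pairing m (ext d) +
    inner ((ec, fc) : hprod Zc Zc) (@coupling_map R Z1 Z2 Zc d).
Proof.
case: m => -[f1 f2] [e1 e2]; case: d => -[[a1 b1] [c1 d1]] [[a2 b2] [c2 d2]].
rewrite /power_pairing /coupling_map !hprod_innerE /=.
by rewrite !innerE (innerC ec b1) (innerC ec b2); ring.
Qed.

Lemma interconnection_pairing0 m fc ec m' fc' ec' :
  power_pairing (left m fc ec) (left m' fc' ec') +
    power_pairing (right m fc ec) (right m' fc' ec') = power_pairing m m'.
Proof.
have := interconnection_pairing m fc ec (left m' fc' ec', right m' fc' ec').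
rewrite /coupling_map /= !subrr => ->.
have -> : ((0, 0) : hprod Zc Zc) = 0 by [].
by rewrite inner0r addr0; case: m' => -[? ?] [? ?].
Qed.

Lemma interconnection_ext (D1 : set H1) (D2 : set H2) d :
  (D1 `*` D2) d -> coupling_map d = 0 -> interconnection D1 D2 (ext d).
Proof.
case: d => -[[a1 b1] [c1 d1]] [[a2 b2] [c2 d2]] [/= Dd1 Dd2] [/subr0_eq b12 d12].
exists b1, d1; split=> //=; rewrite b12; suff -> : - d1 = d2 by [].
by apply/eqP; rewrite eq_sym -addr_eq0 addrC d12.
Qed.

(** For [z] orthogonal to the interconnection, pairing with [z] vanishes on the kernel of the
    coupling map, hence factors through it. The Riesz vector of the resulting functional supplies
    the coupling variables that lift [z] to [D1] and [D2]. *)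
Lemma dirac_interconnection (D1 : set H1) (D2 : set H2) : finite_dimensional Zc ->
  dirac_structure D1 -> dirac_structure D2 ->
  set_surj (D1 `*` D2) [set: hprod Zc Zc] (@coupling_map R Z1 Z2 Zc) ->
  dirac_structure (interconnection D1 D2).
Proof.
move=> /finite_dimensional_frame[s0 /hprod_frame[s sP]] dD1 dD2 surj.
suff E : interconnection D1 D2 = power_orthogonal (interconnection D1 D2).
  by split=> //; rewrite E; exact: subspace_power_orthogonal.
apply/seteqP; split=> [m [fc [ec [L1 R1]]] m' [fc' [ec' [L2 R2]]]|z zD].
  rewrite -(interconnection_pairing0 m fc ec m' fc' ec').
  by rewrite (dirac_pairing dD1)// (dirac_pairing dD2)// addr0.
have /choice[g gP] (v : hprod Zc Zc) :
    exists d : H1 * H2, (D1 `*` D2) d /\ coupling_map d = v.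
  by have [d Dd dv] := surj v Logic.I; exists d.
have D12P a d d' : (D1 `*` D2) d -> (D1 `*` D2) d' -> (D1 `*` D2) (a *: d + d').
  move=> [d1 d2] [d1' d2']; split.
    exact: (((subspaceP _).1 dD1.1).2).
  exact: (((subspaceP _).1 dD2.1).2).
have cP a d d' : @coupling_map R Z1 Z2 Zc (a *: d + d') =
    a *: @coupling_map R Z1 Z2 Zc d + @coupling_map R Z1 Z2 Zc d'.
  rewrite /coupling_map; congr pair => /=.
    by rewrite scalerBr opprD addrACA.
  by rewrite scalerDr addrACA.
have eP a d d' : power_pairing z (ext (a *: d + d')) =
    a * power_pairing z (ext d) + power_pairing z (ext d').
  have -> : ext (a *: d + d') = a *: ext d + ext d' by [].
  rewrite /power_pairing /= innerPl innerDr innerZr; ring.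
pose f v := power_pairing z (ext (g v)).
(* The choice [g] need not be linear: two preimages of the same vector differ by an element of the
   kernel, on which the pairing with [z] is 0. *)
have fE d : (D1 `*` D2) d -> power_pairing z (ext d) = f (coupling_map d).
  move=> Dd; have [Dg gE] := gP (coupling_map d).
  have /zD : interconnection D1 D2 (ext ((-1) *: g (coupling_map d) + d)).
    apply: interconnection_ext; first exact: D12P.
    by rewrite cP gE scaleN1r addNr.
  by rewrite eP mulN1r => /eqP; rewrite addrC subr_eq0 => /eqP.
have [|[q p] kP] := @frame_riesz _ _ s f sP.
  move=> a u v; have [Du uE] := gP u; have [Dv vE] := gP v.
  by rewrite -eP fE ?cP ?uE ?vE//; exact: D12P.
(* The opposite of the Riesz vector, with its components exchanged, cancels the pairing with [z]. *)
have lr d : (D1 `*` D2) d ->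
    power_pairing (left z (- p) (- q)) d.1 +
    power_pairing (right z (- p) (- q)) d.2 = 0.
  move=> Dd; rewrite interconnection_pairing fE// kP.
  have -> : ((- q, - p) : hprod Zc Zc) = - ((q, p) : hprod Zc Zc) by [].
  by rewrite innerNl addrN.
have D10 : D1 0 := ((subspaceP _).1 dD1.1).1.
have D20 : D2 0 := ((subspaceP _).1 dD2.1).1.
have pp0 (Z : hilbertType R) (y : hprod Z Z) : power_pairing y 0 = 0.
  by rewrite /power_pairing inner0l inner0r addr0.
exists (- p), (- q); split.
  by apply: (diracP dD1) => m Dm; have := lr (m, 0) (conj Dm D20); rewrite pp0 addr0.
by apply: (diracP dD2) => m Dm; have := lr (0, m) (conj D10 Dm); rewrite pp0 add0r.
Qed.

Let norm_left m fc ec : `|left m fc ec| <= `|m| + `|((ec, fc) : hprod Zc Zc)|.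
Proof.
rewrite -ler_sqr ?nnegrE ?addr_ge0// sqrrD !hprod_normE2 /=.
have := mulr_ge0 (normr_ge0 m) (normr_ge0 ((ec, fc) : hprod Zc Zc)).
rewrite mulr2n; have := sqr_ge0 `|m.1.2|; have := sqr_ge0 `|m.2.2|; lra.
Qed.

Let norm_right m fc ec : `|right m fc ec| <= `|m| + `|((ec, fc) : hprod Zc Zc)|.
Proof.
rewrite -ler_sqr ?nnegrE ?addr_ge0// sqrrD !hprod_normE2 /= normrN.
have := mulr_ge0 (normr_ge0 m) (normr_ge0 ((ec, fc) : hprod Zc Zc)).
rewrite mulr2n; have := sqr_ge0 `|m.1.1|; have := sqr_ge0 `|m.2.1|; lra.
Qed.

(* Surjectivity of the coupling map lets one read off the coupling variables
   from their pairing with finitely many elements of [D1] and [D2]; for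
   elements of nearby structures the error is absorbed. *)
Lemma coupling_bound (D1 : set H1) (D2 : set H2) : finite_dimensional Zc ->
  set_surj (D1 `*` D2) [set: hprod Zc Zc] (@coupling_map R Z1 Z2 Zc) ->
  exists C eps : R, [/\ 0 <= C, 0 < eps & forall D1' D2',
    pairing_gap_le D1 D1' eps -> pairing_gap_le D2 D2' eps ->
    forall m fc ec, D1' (left m fc ec) -> D2' (right m fc ec) ->
    `|left m fc ec| <= C * `|m| /\ `|right m fc ec| <= C * `|m|].
Proof.
move=> /finite_dimensional_frame[s0 /hprod_frame[s sP]] surj.
have /choice[g gP] (v : hprod Zc Zc) :
    exists d : H1 * H2, (D1 `*` D2) d /\ coupling_map d = v.
  by have [d Dd dv] := surj v Logic.I; exists d.
pose B u := `|ext (g u)| + `|(g u).1| + `|(g u).2|.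
pose K := \sum_(u <- s) B u * `|u|.
have B0 u : 0 <= B u by rewrite !addr_ge0.
have K0 : 0 <= K by apply: sumr_ge0 => u _; rewrite mulr_ge0.
have K1 : 0 < 4 * K + 1 by rewrite ltr_wpDl ?mulr_ge0.
(* This [eps] makes [K * eps] at most 1/4, so the error 2 K eps |k| is absorbed in |k| / 2; what
   remains is |k| / 2 <= 3 K |m|. *)
exists (1 + 6 * K), (4 * K + 1)^-1; split; rewrite ?invr_gt0 ?addr_ge0 ?mulr_ge0//.
set eps := (4 * K + 1)^-1.
have eps0 : 0 < eps by rewrite invr_gt0.
have epsK : eps * (4 * K + 1) = 1 by rewrite mulVf ?gt_eqF.
move=> D1' D2' gap1 gap2 m fc ec Dl Dr.
set k : hprod Zc Zc := (ec, fc).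
set l := left m fc ec in Dl *; set r := right m fc ec in Dr *.
have nl : `|l| <= `|m| + `|k| := norm_left m fc ec.
have nr : `|r| <= `|m| + `|k| := norm_right m fc ec.
(* Expand [k] in the frame: by [interconnection_pairing] its coefficient along [u] is a pairing with
   [m] up to two pairings controlled by the gaps. *)
have kK : `|k| <= K * (`|m| + eps * (`|l| + `|r|)).
  rewrite (le_trans (frame_norm_le (sP k)))// mulr_suml; apply: ler_sum => u _.
  rewrite mulrAC ler_wpM2r//; have [[g1 g2] gE] := gP u.
  have := interconnection_pairing m fc ec (g u); rewrite gE -/k -/l -/r => kE.
  have -> : inner k u = power_pairing l (g u).1 + power_pairing r (g u).2 -
      power_pairing m (ext (g u)) by rewrite kE addrAC subrr add0r.
  have h1 := gap1 _ _ g1 Dl; have h2 := gap2 _ _ g2 Dr.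
  have h3 := le_power_pairing m (ext (g u)).
  rewrite !(power_pairingC _ (g u).1, power_pairingC _ (g u).2).
  rewrite (le_trans (ler_normB _ _))//.
  rewrite (le_trans (lerD (ler_normD _ _) (lexx _)))//.
  rewrite (le_trans (lerD (lerD h1 h2) h3))// -subr_ge0.
  have -> : B u * (`|m| + eps * (`|l| + `|r|)) - (eps * (`|(g u).1| * `|l|) +
      eps * (`|(g u).2| * `|r|) + `|m| * `|ext (g u)|) =
      (`|(g u).1| + `|(g u).2|) * `|m| +
      (`|ext (g u)| + `|(g u).2|) * (eps * `|l|) +
      (`|ext (g u)| + `|(g u).1|) * (eps * `|r|) by rewrite /B; ring.
  by rewrite !addr_ge0 ?mulr_ge0 ?addr_ge0// ltW.
suff k6 : `|k| <= 6 * K * `|m|.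
  by split; rewrite mulrDl mul1r (le_trans nl, le_trans nr)// lerD2l.
have q0 : 0 <= K * eps by rewrite mulr_ge0// ltW.
have q4 : K * eps <= 4^-1 by move: epsK q0; rewrite mulrDr mulr1; lra.
have qK : K * eps <= K by rewrite ler_piMr//; move: epsK q0; rewrite mulrDr; lra.
have e1 : 0 <= (4^-1 - K * eps) * `|k| by rewrite mulr_ge0 ?subr_ge0.
have e2 : 0 <= (K - K * eps) * `|m| by rewrite mulr_ge0 ?subr_ge0.
have : K * (`|m| + eps * (`|l| + `|r|)) <=
    K * `|m| + K * eps * (2 * (`|m| + `|k|)).
  rewrite mulrDr lerD2l [leLHS]mulrA ler_wpM2l//; lra.
lra.
Qed.

Lemma interconnection_gap (X1 X2 : topologicalType)
    (D1 : X1 -> set H1) (D2 : X2 -> set H2) (x : X1 * X2) : finite_dimensional Zc ->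
  dirac_structure (D1 x.1) -> dirac_structure (D2 x.2) ->
  (forall e : R, 0 < e -> \forall y \near x.1, pairing_gap_le (D1 x.1) (D1 y) e) ->
  (forall e : R, 0 < e -> \forall y \near x.2, pairing_gap_le (D2 x.2) (D2 y) e) ->
  set_surj (D1 x.1 `*` D2 x.2) [set: hprod Zc Zc] (@coupling_map R Z1 Z2 Zc) ->
  forall e : R, 0 < e -> \forall y \near x,
    pairing_gap_le (interconnection (D1 x.1) (D2 x.2))
                   (interconnection (D1 y.1) (D2 y.2)) e.
Proof.
move=> fZ dD1 dD2 gap1 gap2 surj e e0.
have [C [eps [C0 eps0 HC]]] := coupling_bound fZ surj.
(* Each of the two pairings of lifts costs a factor [C ^+ 2]; the 1 guards against [C = 0]. *)
have C1 : 0 < 2 * C ^+ 2 + 1 by rewrite ltr_wpDl ?mulr_ge0 ?sqr_ge0.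
have eC : 0 < e / (2 * C ^+ 2 + 1) by rewrite divr_gt0.
(* This lets [coupling_bound] be applied to the lifts of [m] at [x] itself, as well as to those of
   [m'] at [y]. *)
have self (Z : hilbertType R) (D : set (hprod Z Z)) :
    dirac_structure D -> pairing_gap_le D D eps.
  move=> dD m m' Dm Dm'; rewrite (dirac_pairing dD)// normr0.
  by rewrite mulr_ge0 ?mulr_ge0// ltW.
near=> y.
have a1 : pairing_gap_le (D1 x.1) (D1 y.1) eps.
  by near: y; exact: (cvg_fst (gap1 _ eps0)).
have a2 : pairing_gap_le (D2 x.2) (D2 y.2) eps.
  by near: y; exact: (cvg_snd (gap2 _ eps0)).
have b1 : pairing_gap_le (D1 x.1) (D1 y.1) (e / (2 * C ^+ 2 + 1)).
  by near: y; exact: (cvg_fst (gap1 _ eC)).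
have b2 : pairing_gap_le (D2 x.2) (D2 y.2) (e / (2 * C ^+ 2 + 1)).
  by near: y; exact: (cvg_snd (gap2 _ eC)).
move=> m m' [fc [ec [L Rr]]] [fc' [ec' [L' R']]].
have [nl nr] := HC _ _ (self _ _ dD1) (self _ _ dD2) _ _ _ L Rr.
have [nl' nr'] := HC _ _ a1 a2 _ _ _ L' R'.
rewrite -(interconnection_pairing0 m fc ec m' fc' ec').
rewrite (le_trans (ler_normD _ _))//.
have := lerD (b1 _ _ L L') (b2 _ _ Rr R') => /le_trans; apply.
rewrite -mulrDr mulrAC ler_pdivrMr// -mulrA ler_pM2l//.
have := ler_pM (normr_ge0 _) (normr_ge0 _) nl nl'.
have := ler_pM (normr_ge0 _) (normr_ge0 _) nr nr'.
have := mulr_ge0 (normr_ge0 m) (normr_ge0 m').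
rewrite !(mulrACA C _ C) -expr2.
move: (`|m| * `|m'|) => M M0 h1 h2.
rewrite (le_trans (lerD h2 h1))// mulrDr mulr1.
have -> : C ^+ 2 * M + C ^+ 2 * M = M * (2 * C ^+ 2) by ring.
by rewrite lerDl.
Unshelve. all: by end_near. Qed.

End interconnection.

Theorem proposition3 (R : realType) (X1 X2 : topologicalType)
    (Z1 Z2 Zc : hilbertType R)
    (D1 : X1 -> set (hprod (hprod Z1 Zc) (hprod Z1 Zc)))
    (D2 : X2 -> set (hprod (hprod Z2 Zc) (hprod Z2 Zc))) :
  finite_dimensional Zc ->
  modulated_dirac_structure D1 ->
  modulated_dirac_structure D2 ->
  (forall (x1 : X1) (x2 : X2),
    set_surj (D1 x1 `*` D2 x2) [set: hprod Zc Zc]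
      (@coupling_map R Z1 Z2 Zc)) ->
  modulated_dirac_structure
    (fun x : X1 * X2 => interconnection (D1 x.1) (D2 x.2)).
Proof.
move=> fZ mD1 mD2 surj; apply: gap_modulated_dirac => [x|x].
  by apply: dirac_interconnection => //; [exact: mD1.1|exact: mD2.1].
apply: interconnection_gap => //; [exact: mD1.1|exact: mD2.1| |].
  exact: modulated_dirac_gap.
exact: modulated_dirac_gap.
Qed.
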